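(* Let $x,y,z$ be indeterminates, and let $(A_{n,k})_{n,k\ge 0}$ be defined by $A_{0,0}=1$, $A_{0,k}=0$ for $k>0$, and for $n\ge 1$: $A_{n,0}=xA_{n-1,0}+zA_{n-1,1}$ and $A_{n,k}=A_{n-1,k-1}+yA_{n-1,k}+zA_{n-1,k+1}$ for $k\ge 1$. Let $A^{*}_{n,k}$ denote $A_{n,k}$ with $x$ replaced by $y$ (i.e. the array defined by the same recurrence with $A^*_{n,0}=yA^*_{n-1,0}+zA^*_{n-1,1}$). For any integers $n,r\ge 0$ and $m\ge \ell\ge 0$, set $M_r=\min\{n+r+1,\,m+r-\ell\}$. Then $$\sum_{k=0}^{M_r} z^k\det\begin{pmatrix} A_{n,k} & A_{m,k+\ell+1}\\ A_{n+r+1,k} & A_{m+r+1,k+\ell+1}\end{pmatrix}=\sum_{i=0}^{r}A_{n+i,0}\,A^{*}_{m+r-i,\ell}.$$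
   Context: In the paper's terminology, $(A_{n,k})$ is the recursive matrix $\mathcal{A}^{\sigma,\tau}$ with $\sigma=(x,y,y,\ldots)$, $\tau=(z,z,z,\ldots)$, i.e. $A_{n,k}=A_{n-1,k-1}+\sigma_kA_{n-1,k}+\tau_{k+1}A_{n-1,k+1}$ with $A_{n-1,-1}=0$; one has $A_{n,k}=0$ for $k>n$. *)

(* Defs.v *)
From HB Require Import structures.
From mathcomp Require Import all_boot all_order all_algebra.

Set Implicit Arguments.
Unset Strict Implicit.
Unset Printing Implicit Defensive.

Import GRing.Theory.
Local Open Scope ring_scope.

(* The indeterminates x, y, z are arbitrary elements of a commutative ring;
   R = Z[x,y,z] with its three variables is the generic instance. *)
Fixpoint recA (R : comNzRingType) (x y z : R) (n k : nat) {struct n} : R :=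
  match n, k with
  | 0%N, 0%N => 1
  | 0%N, _.+1 => 0
  | n'.+1, 0%N => x * recA x y z n' 0 + z * recA x y z n' 1
  | n'.+1, k'.+1 =>
      recA x y z n' k' + y * recA x y z n' k'.+1 + z * recA x y z n' k'.+2
  end.

Definition recAstar (R : comNzRingType) (y z : R) (n k : nat) : R :=
  recA y y z n k.

Definition mx22 (R : comNzRingType) (a b c d : R) : 'M[R]_2 :=
  \matrix_(i < 2, j < 2)
    if i == ord0 then (if j == ord0 then a else b)
    else (if j == ord0 then c else d).

(* Main.v *)
Require Import Defs.
From HB Require Import structures.
From mathcomp Require Import all_boot all_order all_algebra.
From mathcomp Require Import zify ring.

Set Implicit Arguments.
Unset Strict Implicit.
Unset Printing Implicit Defensive.

Import GRing.Theory.
Local Open Scope ring_scope.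

(** Put [S(a,b) = \sum_k z^k A_{a,k} A_{b,k+l+1}]. The recurrence makes
    [S(a,b+1) - S(a+1,b)] collapse to its boundary contribution
    [A_{a,0} (A_{b,l} + (y - x) A_{b,l+1})], and the second factor is
    [A*_{b,l}]. The left-hand side of the theorem is
    [S(n,m+r+1) - S(n+r+1,m)], which telescopes into such differences along
    the antidiagonal [(n+i, m+r-i)]. *)

Lemma recA_eq0 (R : comNzRingType) (x y z : R) (n k : nat) :
  (n < k)%N -> recA x y z n k = 0.
Proof.
elim: n k => [|n IHn] [|k] //= ltnk.
by rewrite !IHn ?mulr0 ?addr0 //; lia.
Qed.

(** The right-hand side obeys the recurrence of [recAstar]: in column 0, the term
    [(y - x) * recA x y z n 0] coming from column 1 turns the weight [x] into [y]. *)
Lemma recAstarE (R : comNzRingType) (x y z : R) (n k : nat) :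
  recAstar y z n k = recA x y z n k + (y - x) * recA x y z n k.+1.
Proof.
rewrite /recAstar; elim: n k => [|n IHn] [|k] /=; rewrite ?mulr0 ?addr0 //.
  by rewrite !IHn; ring.
by rewrite !IHn; ring.
Qed.

Lemma det_mx22 (R : comNzRingType) (a b c d : R) :
  \det (mx22 a b c d) = a * d - b * c.
Proof.
rewrite (expand_det_row _ ord0) big_ord_recl big_ord1 /cofactor !det_mx11 !mxE /=.
by rewrite expr0 expr1; ring.
Qed.

Definition shifted_sum (R : comNzRingType) (x y z : R) (l K a b : nat) : R :=
  \sum_(0 <= k < K) z ^+ k * (recA x y z a k * recA x y z b (k + l).+1).

(** With T_k = z^k (A_{a,k-1} A_{b,k+l+1} - A_{a,k} A_{b,k+l}), the k-th summand is T_{k+1} - T_k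
    for k > 0, as the [y] terms cancel; T_{K+1} survives at the top. *)
Lemma shifted_sumB (R : comNzRingType) (x y z : R) (l K a b : nat) :
  shifted_sum x y z l K.+1 a b.+1 - shifted_sum x y z l K.+1 a.+1 b =
  recA x y z a 0 * recAstar y z b l
  + z ^+ K.+1 * (recA x y z a K * recA x y z b (K + l).+2
                 - recA x y z a K.+1 * recA x y z b (K + l).+1).
Proof.
rewrite (recAstarE x) /shifted_sum; elim: K => [|K IHK].
  by rewrite !big_nat1 /= add0n; ring.
rewrite big_nat_recr //= [X in _ - X]big_nat_recr //= addSn.
by rewrite opprD addrACA IHK !exprS; ring.
Qed.

Lemma shifted_sumB_full (R : comNzRingType) (x y z : R) (l K a b : nat) :
  (a < K)%N ->
  shifted_sum x y z l K.+1 a b.+1 - shifted_sum x y z l K.+1 a.+1 b =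
  recA x y z a 0 * recAstar y z b l.
Proof.
move=> ltaK; rewrite shifted_sumB (recA_eq0 x y z ltaK) (recA_eq0 x y z (leqW ltaK)).
by rewrite !mul0r subrr mulr0 addr0.
Qed.

Theorem theorem1p3 (R : comNzRingType) (x y z : R) (n r m l : nat)
    (hlm : (l <= m)%N) :
  \sum_(0 <= k < (minn (n + r + 1) (m + r - l)).+1)
     z ^+ k * \det (mx22 (recA x y z n k)           (recA x y z m (k + l + 1))
                         (recA x y z (n + r + 1) k) (recA x y z (m + r + 1) (k + l + 1)))
  = \sum_(0 <= i < r.+1) recA x y z (n + i) 0 * recAstar y z (m + r - i) l.
Proof.
(* One cutoff for all pairs: every [n + i] with [i <= r] lies below [n + r + 1], so each top
   boundary term vanishes. *)
pose S := shifted_sum x y z l (n + r + 1).+1.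
transitivity (S n (m + r + 1)%N - S (n + r + 1)%N m).
  rewrite /S /shifted_sum -sumrB.
  rewrite [RHS](@big_cat_nat _ _ _ (minn (n + r + 1) (m + r - l)).+1) //=; last lia.
  rewrite [X in _ = _ + X]big_nat_cond [X in _ = _ + X]big1 ?addr0.
    by apply: eq_bigr => k _; rewrite det_mx22 (addn1 (k + l)); ring.
  (* The tail is nonempty only if the minimum is [m + r - l]; then [k + l + 1] exceeds [m + r + 1],
     and the second factors vanish in both sums. *)
  move=> k; rewrite andbT => /andP[ltMk ltkn].
  by rewrite !(@recA_eq0 _ x y z _ (k + l).+1) ?mulr0 ?subrr //; lia.
(* The sign makes [f i.+1 - f i] the difference in [shifted_sumB_full] at [a = n + i],
   [b = m + r - i]. *)
pose f i := - S (n + i)%N (m + r + 1 - i)%N.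
have -> : S n (m + r + 1)%N - S (n + r + 1)%N m = f r.+1 - f 0%N.
  rewrite /f addn0 subn0 opprK addrC -addnA addn1.
  by congr (- S _ _ + _); lia.
rewrite -telescope_sumr //; apply: eq_big_nat => i /andP[_ ltir].
rewrite /f opprK addrC (addnS n i).
have -> : (m + r + 1 - i)%N = (m + r - i).+1 by lia.
have -> : (m + r + 1 - i.+1)%N = (m + r - i)%N by lia.
by apply: shifted_sumB_full; lia.
Qed.
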